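(* Let $f:M\to\mathbb{R}^3$ be a CMC surface with $H=1$ (not a round sphere), Gauss map $N$ and dual surface $g=f+N$. For $\mu\in\mathbb{C}\setminus\{0,\pm1\}$ let $\varrho=-\frac{(\mu-1)^2}{4\mu}$, $a=\frac{\mu+\mu^{-1}}2$ and $b=i\frac{\mu^{-1}-\mu}2$. If a $\mathrm{d}_\varrho$-parallel section $\varphi=e\alpha+\psi\beta$ on $\tilde M$ satisfies at some fixed point $p_0\in\tilde M$ $$\beta(p_0)=\tfrac12\big(N(p_0)\alpha(p_0)(a-1)+\alpha(p_0)b\big),$$ then $\alpha$ is $d^N_\mu$-parallel. All $d^N_\mu$-parallel sections arise this way.
   Context: $\mathbb{H}=\mathrm{span}_{\mathbb{R}}\{1,i,j,k\}=\mathbb{R}^4$ are the quaternions, $\mathbb{R}^3=\mathrm{Im}\,\mathbb{H}$, $S^2=\{n\in \mathrm{Im}\,\mathbb{H}: n^2=-1\}$, $\mathbb{C}=\mathrm{span}_{\mathbb{R}}\{1,i\}\subset\mathbb{H}$; complex scalars act on $\mathbb{H}$ and $\mathbb{H}^2$ by right multiplication. $M$ is a Riemann surface with universal cover $\tilde M$ (maps on $M$ are lifted to $\tilde M$ without change of notation); $*\omega(X)=\omega(JX)$. CMC surface with $H=1$: conformal immersion $f:M\to\mathbb{R}^3$ with Gauss map $N:M\to S^2$ ($*df=N\,df=-df\,N$) and constant mean curvature $1$, i.e. $df=-\frac12(dN-N*dN)$. Round spheres are excluded. CMC family: for $\lambda\in\mathbb{C}\setminus\{0\}$, $d^N_\lambda\alpha=d\alpha+\frac12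 df\,(N\alpha(a_\lambda-1)+\alpha b_\lambda)$ for $\alpha:\tilde M\to\mathbb{H}$, with $a_\lambda=\frac{\lambda+\lambda^{-1}}2$, $b_\lambda=i\frac{\lambda^{-1}-\lambda}2$; this is a flat connection. Isothermic family: with $e=\begin{pmatrix}1\\0\end{pmatrix}$, $\psi=\begin{pmatrix}f\\1\end{pmatrix}$, the flat connection $\mathrm{d}_\varrho$ on the trivial $\mathbb{H}^2=\mathbb{C}^4$ bundle is $\mathrm{d}_\varrho\varphi=d\varphi+\eta\varphi\varrho$, with $\eta=\begin{pmatrix} f\,dg & -f\,dg\,f\\ dg&-dg\,f\end{pmatrix}$. Equivalently, $\varphi=e\alpha+\psi\beta$ is $\mathrm{d}_\varrho$-parallel iff $d\alpha=-df\,\beta$ and $d\beta=-dg\,\alpha\varrho$. *)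

(* Defs.v *)
From HB Require Import structures.
From mathcomp Require Import all_boot all_order all_algebra.
From mathcomp Require Import all_classical all_reals all_analysis.
From mathcomp Require Import complex.
From mathcomp Require Import ring.

Set Implicit Arguments.
Unset Strict Implicit.
Unset Printing Implicit Defensive.

Import Order.TTheory GRing.Theory Num.Theory.
Import numFieldNormedType.Exports.

Local Open Scope classical_set_scope.
Local Open Scope ring_scope.

Record quat (R : Type) : Type :=
  Quat { qre : R; qi : R; qj : R; qk : R }.

Section QuatStructure.
Variable R : realType.
Implicit Types p q : quat R.

Definition quat_to p : R * R * R * R := (qre p, qi p, qj p, qk p).
Definition quat_of (t : R * R * R * R) : quat R :=
  Quat t.1.1.1 t.1.1.2 t.1.2 t.2.

Lemma quat_toK : cancel quat_to quat_of. Proof. by case. Qed.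

HB.instance Definition _ := Choice.copy (quat R) (can_type quat_toK).

Definition qzero : quat R := Quat 0 0 0 0.
Definition qone : quat R := Quat 1 0 0 0.
Definition qopp p := Quat (- qre p) (- qi p) (- qj p) (- qk p).
Definition qadd p q :=
  Quat (qre p + qre q) (qi p + qi q) (qj p + qj q) (qk p + qk q).
Definition qmul p q := Quat
  (qre p * qre q - qi p * qi q - qj p * qj q - qk p * qk q)
  (qre p * qi q + qi p * qre q + qj p * qk q - qk p * qj q)
  (qre p * qj q - qi p * qk q + qj p * qre q + qk p * qi q)
  (qre p * qk q + qi p * qj q - qj p * qi q + qk p * qre q).
Definition qscale (c : R) q := Quat (c * qre q) (c * qi q) (c * qj q) (c * qk q).

Lemma qaddA : associative qadd.
Proof. by move=> p q r; rewrite /qadd /= !addrA. Qed.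
Lemma qaddC : commutative qadd.
Proof. by move=> p q; rewrite /qadd; congr Quat; rewrite addrC. Qed.
Lemma qadd0 : left_id qzero qadd.
Proof. by case=> *; rewrite /qadd /= !add0r. Qed.
Lemma qaddN : left_inverse qzero qopp qadd.
Proof. by case=> *; rewrite /qadd /= !addNr. Qed.

HB.instance Definition _ :=
  GRing.isZmodule.Build (quat R) qaddA qaddC qadd0 qaddN.

Lemma qmulA : associative qmul.
Proof. by move=> p q r; rewrite /qmul /=; congr Quat; ring. Qed.
Lemma qmul1l : left_id qone qmul.
Proof. by case=> *; rewrite /qmul /=; congr Quat; ring. Qed.
Lemma qmul1r : right_id qone qmul.
Proof. by case=> *; rewrite /qmul /=; congr Quat; ring. Qed.
Lemma qmulDl : left_distributive qmul +%R.
Proof. by move=> p q r; rewrite /qmul /=; congr Quat => /=; ring. Qed.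
Lemma qmulDr : right_distributive qmul +%R.
Proof. by move=> p q r; rewrite /qmul /=; congr Quat => /=; ring. Qed.
Lemma qone_neq0 : qone != 0.
Proof. by apply/eqP => -[] /eqP; rewrite oner_eq0. Qed.

HB.instance Definition _ := GRing.Zmodule_isNzRing.Build (quat R)
  qmulA qmul1l qmul1r qmulDl qmulDr qone_neq0.

Lemma qscaleA a b q : qscale a (qscale b q) = qscale (a * b) q.
Proof. by rewrite /qscale /= !mulrA. Qed.
Lemma qscale1 : left_id 1 qscale.
Proof. by case=> *; rewrite /qscale /= !mul1r. Qed.
Lemma qscaleDr : right_distributive qscale +%R.
Proof. by move=> a p q; rewrite /qscale /= !mulrDr. Qed.
Lemma qscaleDl q : {morph qscale^~ q : a b / a + b}.
Proof. by move=> a b; rewrite /qscale /= !mulrDl. Qed.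

HB.instance Definition _ := GRing.Zmodule_isLmodule.Build R (quat R)
  qscaleA qscale1 qscaleDr qscaleDl.

Lemma qscaleAl (a : R) p q : a *: (p * q) = a *: p * q.
Proof. by congr Quat => /=; ring. Qed.
HB.instance Definition _ := GRing.Lmodule_isLalgebra.Build R (quat R) qscaleAl.

Lemma qscaleAr (a : R) p q : a *: (p * q) = p * (a *: q).
Proof. by congr Quat => /=; ring. Qed.
HB.instance Definition _ := GRing.Lalgebra_isAlgebra.Build R (quat R) qscaleAr.

Definition qdot p q : R :=
  qre p * qre q + qi p * qi q + qj p * qj q + qk p * qk q.

(* R^3 = Im H *)
Definition imH : set (quat R) := [set q | qre q = 0].

Definition S2 : set (quat R) := [set n | imH n /\ n * n = - 1].

(* C = span_R {1, i} inside H *)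
Definition cplxH (z : R[i]) : quat R := Quat (complex.Re z) (complex.Im z) 0 0.

End QuatStructure.

Notation "z %:H" := (cplxH z) (format "z %:H") : ring_scope.

(* Charts take values in R * R, which stands for the complex plane. *)
Record chart (R : realType) (M : topologicalType) := Chart {
  chart_dom : set M;
  chart_map :> M -> R * R;
  chart_inv : R * R -> M;
  chart_dom_open : open chart_dom;
  chart_img_open : open (chart_map @` chart_dom);
  chart_mapK : {in chart_dom, cancel chart_map chart_inv};
  chart_map_cont : {within chart_dom, continuous chart_map};
  chart_inv_cont : {within chart_map @` chart_dom, continuous chart_inv}
}.

Definition chart_img (R : realType) (M : topologicalType) (z : chart R M) :
  set (R * R) := z @` chart_dom z.

Section Surfaces.
Variable R : realType.

(* Multiplication by i on R * R = C. *)
Definition Jrot (v : R * R) : R * R := (- v.2, v.1).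

(* The differential of a holomorphic map is complex linear. *)
Definition holomorphic_on (U : set (R * R)) (h : R * R -> R * R) :=
  forall w, U w ->
    differentiable h w /\ forall v, 'd h w (Jrot v) = Jrot ('d h w v).

Definition riemann_surface (M : topologicalType) (A : set (chart R M)) :=
  [/\ hausdorff_space M,
      connected [set: M],
      (forall p : M, exists2 z, A z & chart_dom z p)
    & (forall z z', A z -> A z' ->
        holomorphic_on (z @` (chart_dom z `&` chart_dom z'))
          (z' \o chart_inv z))].

Definition evenly_covered (Mt M : topologicalType) (cov : Mt -> M) (U : set M) :=
  exists (I : Type) (V : I -> set Mt) (s : I -> M -> Mt),
  [/\ cov @^-1` U = \bigcup_i V i,
      (forall i j, V i `&` V j !=set0 -> i = j),
      (forall i, open (V i)),
      (forall i, set_bij U (V i) (s i) /\ {in U, cancel (s i) cov})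
    & (forall i, {within U, continuous (s i)})].

Definition covering_map (Mt M : topologicalType) (cov : Mt -> M) :=
  [/\ continuous cov, set_surj setT setT cov
    & forall p, exists U, [/\ open U, U p & evenly_covered cov U]].

Definition path_connected (T : topologicalType) :=
  forall x y : T, exists c : R -> T,
    [/\ {within `[0, 1], continuous c}, c 0 = x & c 1 = y].

Definition loops_contract (T : topologicalType) :=
  forall c : R -> T, {within `[0, 1], continuous c} -> c 0 = c 1 ->
    exists H : R * R -> T,
    [/\ {within `[0, 1] `*` `[0, 1], continuous H},
        (forall s, 0 <= s <= 1 -> H (s, 0) = c s /\ H (s, 1) = c 0)
      & (forall t, 0 <= t <= 1 -> H (0, t) = c 0 /\ H (1, t) = c 0)].

Definition simply_connected (T : topologicalType) :=
  path_connected T /\ loops_contract T.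

Definition universal_cover (Mt M : topologicalType) (cov : Mt -> M) :=
  covering_map cov /\ simply_connected Mt.

(* The complex structure of a covering space: its charts are the z \o cov, for
   z a chart of the base, on the open sets where this is a chart. *)
Definition lift_atlas (Mt M : topologicalType) (cov : Mt -> M)
    (A : set (chart R M)) : set (chart R Mt) :=
  [set zt | exists2 z, A z & forall q, chart_dom zt q ->
      chart_dom z (cov q) /\ zt q = z (cov q)].

Fixpoint Cn_on (n : nat) (U : set (R * R)) (F : R * R -> R) : Prop :=
  match n with
  | 0 => forall w, U w -> {for w, continuous F}
  | n'.+1 => (forall w, U w -> differentiable F w) /\
             (forall v, Cn_on n' U (fun w => 'd F w v))
  end.

Definition smooth_on (U : set (R * R)) (F : R * R -> R) :=
  forall n, Cn_on n U F.

Section Calculus.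
Variables (M : topologicalType) (A : set (chart R M)).
Implicit Types (z : chart R M) (p : M) (v : R * R) (f N : M -> quat R).

Definition smooth_map f := forall z, A z ->
  [/\ smooth_on (chart_img z) (fun w => qre (f (chart_inv z w))),
      smooth_on (chart_img z) (fun w => qi (f (chart_inv z w))),
      smooth_on (chart_img z) (fun w => qj (f (chart_inv z w)))
    & smooth_on (chart_img z) (fun w => qk (f (chart_inv z w)))].

(* d z f p v is df_p(X), where the tangent vector X at p has the coordinates v
   in the chart z; JX then has the coordinates Jrot v. *)
Definition d z f p v : quat R := Quat
  ('d (fun w => qre (f (chart_inv z w)) : R) (z p) v)
  ('d (fun w => qi (f (chart_inv z w)) : R) (z p) v)
  ('d (fun w => qj (f (chart_inv z w)) : R) (z p) v)
  ('d (fun w => qk (f (chart_inv z w)) : R) (z p) v).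

Definition star (omega : R * R -> quat R) : R * R -> quat R :=
  fun v => omega (Jrot v).

Definition on_tangent (P : chart R M -> M -> R * R -> Prop) :=
  forall z p v, A z -> chart_dom z p -> P z p v.

Definition conformal_immersion f :=
  [/\ smooth_map f,
      (forall p, imH (f p)),
      on_tangent (fun z p v => d z f p v = 0 -> v = 0)
    & on_tangent (fun z p v =>
        qdot (star (d z f p) v) (star (d z f p) v) =
          qdot (d z f p v) (d z f p v) /\
        qdot (d z f p v) (star (d z f p) v) = 0)].

Definition gauss_map f N :=
  [/\ smooth_map N,
      (forall p, S2 (N p))
    & on_tangent (fun z p v =>
        star (d z f p) v = N p * d z f p v /\
        star (d z f p) v = - (d z f p v * N p))].

(* The last clause expresses that the mean curvature is constantly 1. *)
Definition cmc1_surface f N :=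
  [/\ conformal_immersion f,
      gauss_map f N
    & on_tangent (fun z p v =>
        d z f p v = - (2^-1 *: (d z N p v - N p * star (d z N p) v)))].

(* M need not be compact, so a piece of a round sphere counts as round. *)
Definition round_sphere f :=
  exists (c : quat R) (r : R),
    [/\ imH c, 0 < r & forall p, qdot (f p - c) (f p - c) = r ^+ 2].

Definition dual_surface f N : M -> quat R := fun p => f p + N p.

Definition a_ (lambda : R[i]) : R[i] := (lambda + lambda^-1) / 2.
Definition b_ (lambda : R[i]) : R[i] := 'i * ((lambda^-1 - lambda) / 2).

Definition dN (lambda : R[i]) f N (alpha : M -> quat R) z p v : quat R :=
  d z alpha p v + 2^-1 *: (d z f p v *
    (N p * alpha p * (a_ lambda - 1)%:H + alpha p * (b_ lambda)%:H)).

Definition dN_parallel (lambda : R[i]) f N (alpha : M -> quat R) :=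
  smooth_map alpha /\ on_tangent (fun z p v => dN lambda f N alpha z p v = 0).

Definition col2 (x y : quat R) : 'cV[quat R]_2 := \col_(i < 2) [:: x; y]`_i.

Definition mx2 (x y x' y' : quat R) : 'M[quat R]_2 :=
  \matrix_(i < 2, j < 2) (nth [::] [:: [:: x; y]; [:: x'; y']] i)`_j.

(* The right action of H on H^2. *)
Definition rscale (u : 'cV[quat R]_2) (q : quat R) : 'cV[quat R]_2 :=
  \col_i (u i 0 * q).

Definition e_vec : 'cV[quat R]_2 := col2 1 0.
Definition psi_vec f p : 'cV[quat R]_2 := col2 (f p) 1.

(* e alpha + psi beta *)
Definition section_of f (alpha beta : M -> quat R) : M -> 'cV[quat R]_2 :=
  fun p => rscale e_vec (alpha p) + rscale (psi_vec f p) (beta p).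

Definition eta f (g : M -> quat R) z p v : 'M[quat R]_2 :=
  mx2 (f p * d z g p v) (- (f p * d z g p v * f p))
      (d z g p v)       (- (d z g p v * f p)).

Definition drho (rho : R[i]) f (g : M -> quat R) (phi : M -> 'cV[quat R]_2)
    z p v : 'cV[quat R]_2 :=
  \col_i d z (fun q => phi q i 0) p v +
  rscale (eta f g z p v *m phi p) rho%:H.

Definition drho_parallel (rho : R[i]) f (g : M -> quat R)
    (phi : M -> 'cV[quat R]_2) :=
  (forall i, smooth_map (fun q => phi q i 0)) /\
  on_tangent (fun z p v => drho rho f g phi z p v = 0).

End Calculus.
End Surfaces.

(* Main.v *)
(* Put c = a - 1, s = b and B(alpha) = (N alpha c + alpha s) / 2, so that alpha
   is d^N_mu-parallel iff d alpha = - df B(alpha). For a parallel section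
   e alpha + psi beta the defect delta = beta - B(alpha) satisfies the linear
   equation d delta = (N df delta c + df delta s) / 2, because N df = - df N,
   N^2 = -1, c^2 + s^2 = - 2 c and rho = - c / 2. By Gronwall's inequality along
   segments in a chart, the zero set of delta is open and closed, so delta = 0
   as soon as it vanishes at p0. The same computation with delta = 0 shows that
   beta = B(alpha) completes any d^N_mu-parallel alpha to a parallel section. *)

From HB Require Import structures.
Require Import Defs.
From mathcomp Require Import all_boot all_order all_algebra.
From mathcomp Require Import all_classical all_reals all_analysis.
From mathcomp Require Import complex.
From mathcomp Require Import ring lra.

Set Implicit Arguments.
Unset Strict Implicit.
Unset Printing Implicit Defensive.

Import Order.TTheory GRing.Theory Num.Theory.
Import numFieldNormedType.Exports.
Local Open Scope classical_set_scope.
Local Open Scope ring_scope.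

(** * Differentials of maps that agree near a point *)

Lemma is_diff_near0 (K : numFieldType) (V W : normedModType K) (H : V -> W)
    (x : V) : (\forall y \near x, H y = 0) -> is_diff x H 0.
Proof.
move=> H0.
have Hx : H x = 0 by exact: nbhs_singleton H0.
have cont0 : continuous (\0 : V -> W) by move=> y; exact: cvg_cst.
have shift_cvg : y + x @[y --> (0 : V)] --> x.
  by rewrite -[X in _ --> X](add0r x); apply: cvgD; [exact: cvg_id|exact: cvg_cst].
have H0' : \forall y \near (0 : V), H (y + x) = 0 by exact: shift_cvg H0.
(* Near 0 the left side vanishes, so the remainder is trivially little-o; uniqueness of the
   differential then forces it to be 0. *)
have E : H \o shift x = cst (H x) + \0 +o_ 0 id.
  apply/eqaddoP => _/posnumP[e]; near=> y.
  rewrite !fctE /= Hx addr0 subr0 (near H0' y) ?normr0 ?mulr_ge0 //.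
have dE : 'd H x = \0 :> (V -> W) by exact: (@diff_unique _ _ _ _ \0).
by apply: DiffDef; first (apply/diff_locallyP; rewrite dE).
Unshelve. all: by end_near. Qed.

(** [G] is [F] plus [G - F], and the latter vanishes near [x], hence has differential 0 there. *)
Lemma near_eq_is_diff (K : numFieldType) (V W : normedModType K)
    (F G : V -> W) (x : V) :
  (\forall y \near x, F y = G y) -> differentiable F x ->
  is_diff x G ('d F x).
Proof.
move=> FG /differentiableP dF.
have dGF : is_diff x (G - F) 0.
  apply: is_diff_near0; near=> y; rewrite !fctE; apply/eqP; rewrite subr_eq0.
  by apply/eqP/esym; near: y.
have GE : G = F + (G - F) by rewrite funeqE => y; rewrite !fctE addrC subrK.
have [dGF1 dGF2] := dGF; have dF1 : differentiable F x by case: dF.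
rewrite GE; apply: DiffDef; first exact: differentiableD.
by apply/funext => y; rewrite (diffD dF1 dGF1) /= dGF2 addr0.
Unshelve. all: by end_near. Qed.

(* Locked: unfolding ['d] and [differentiable] makes unification compare the
   topologies of [R * R] and take minutes. *)
HB.lock Definition dif (R : realType) (F : R * R -> R) (w : R * R) : Prop :=
  differentiable F w.
HB.lock Definition pd (R : realType) (F : R * R -> R) (w v : R * R) : R :=
  'd F w v.

(** * Real functions on the plane: differentiation rules and the classes [Cn_on] *)

Section PlaneDerivative.
Variable R : realType.
Implicit Types (U : set (R * R)) (F G : R * R -> R) (w v : R * R).

Lemma pd_near F G w : (\forall y \near w, F y = G y) -> dif F w ->
  dif G w /\ forall v, pd G w v = pd F w v.
Proof.
rewrite dif.unlock pd.unlock => FG dF; have [dG E] := near_eq_is_diff FG dF.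
by split=> [|v]; [exact: dG|exact: (congr1 (fun h => h v) E)].
Qed.

Lemma difD F G w : dif F w -> dif G w -> dif (fun y => F y + G y) w.
Proof. rewrite dif.unlock; exact: differentiableD. Qed.

Lemma pdD F G w v : dif F w -> dif G w ->
  pd (fun y => F y + G y) w v = pd F w v + pd G w v.
Proof.
rewrite dif.unlock pd.unlock => dF dG.
exact: (congr1 (fun h => h v) (diffD dF dG)).
Qed.

Lemma difM F G w : dif F w -> dif G w -> dif (fun y => F y * G y) w.
Proof. rewrite dif.unlock; exact: differentiableM. Qed.

Lemma pdM F G w v : dif F w -> dif G w ->
  pd (fun y => F y * G y) w v = F w * pd G w v + G w * pd F w v.
Proof.
rewrite dif.unlock pd.unlock => dF dG.
exact: (congr1 (fun h => h v) (diffM dF dG)).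
Qed.

Lemma dif_cst (k : R) w : dif (fun=> k) w.
Proof. rewrite dif.unlock; exact: differentiable_cst. Qed.

Lemma pd_cst (k : R) w v : pd (fun=> k) w v = 0.
Proof. by rewrite pd.unlock diff_cst. Qed.

Lemma dif_continuous F w : dif F w -> {for w, continuous F}.
Proof. rewrite dif.unlock; exact: differentiable_continuous. Qed.

(** The difference quotient along the line is the one of [F] in direction [v]. This reduces
    estimates in a chart to one real variable. *)
Lemma is_derive_line F w v (t : R) : dif F (w + t *: v) ->
  is_derive t 1 (fun s : R => F (w + s *: v)) (pd F (w + t *: v) v).
Proof.
rewrite dif.unlock pd.unlock => dF; rewrite -(deriveE _ dF).
have E : (fun h : R => h^-1 *: (((fun s => F (w + s *: v)) \o shift t) (h *: 1) -
    F (w + t *: v))) =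
  (fun h => h^-1 *: ((F \o shift (w + t *: v)) (h *: v) - F (w + t *: v))).
  apply/funext => h /=; congr (_ *: (F _ - _)).
  by rewrite [h *: 1]mulr1 scalerDl addrCA.
by apply: DeriveDef; rewrite /derivable /derive /= E; first exact: diff_derivable dF.
Qed.

(** Restates the recursion with the locked derivative, so that the inductions below never unfold
    differentials. *)
Lemma Cn_onS n U F : Cn_on n.+1 U F <->
  (forall w, U w -> dif F w) /\ forall v, Cn_on n U (fun w => pd F w v).
Proof. by rewrite dif.unlock pd.unlock. Qed.

Lemma difN F w : dif F w -> dif (fun y => - F y) w.
Proof.
move=> dF; rewrite (_ : (fun _ => _) = fun y => -1 * F y).
  exact/difM/dF/dif_cst.
by apply/funext => y; rewrite mulN1r.
Qed.

Lemma pdN F w v : dif F w -> pd (fun y => - F y) w v = - pd F w v.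
Proof.
move=> dF; rewrite (_ : (fun _ => _) = fun y => -1 * F y).
  by rewrite pdM ?pd_cst ?mulr0 ?addr0 ?mulN1r //; exact: dif_cst.
by apply/funext => y; rewrite mulN1r.
Qed.

(** As [U] is open, equality on [U] is equality near each of its points and so passes to derivatives
    of all orders. *)
Lemma Cn_on_eq n U F G :
  open U -> (forall w, U w -> F w = G w) -> Cn_on n U F -> Cn_on n U G.
Proof.
have near U' (F' G' : R * R -> R) w : open U' ->
    (forall w, U' w -> F' w = G' w) -> U' w -> \forall y \near w, F' y = G' y.
  by move=> oU FG Uw; apply: filterS FG (open_nbhs_nbhs (conj oU Uw)).
elim: n F G => [|n IH] F G oU FG.
  move=> cF w Uw; suff : G y @[y --> w] --> F w by rewrite FG.
  by apply: cvg_trans (cF _ Uw); exact/near_eq_cvg/near/Uw.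
move=> /Cn_onS[dF CF]; apply/Cn_onS.
have dG w : U w -> dif G w /\ forall v, pd G w v = pd F w v.
  by move=> Uw; exact/pd_near/dF/Uw/near/Uw.
split=> [w /dG[]//|v]; apply: IH (CF v) => // w Uw.
by have [_ ->] := dG _ Uw.
Qed.

Lemma Cn_on_sub n U U' F : U' `<=` U -> Cn_on n U F -> Cn_on n U' F.
Proof.
move=> UU; elim: n F => [|n IH] F; first by move=> cF w /UU; exact: cF.
move=> /Cn_onS[dF CF]; apply/Cn_onS.
by split=> [w /UU|v]; [exact: dF|exact/IH].
Qed.

Lemma Cn_onW n U F : Cn_on n.+1 U F -> Cn_on n U F.
Proof.
elim: n F => [|n IH] F /Cn_onS[dF CF].
  by move=> w Uw; exact/dif_continuous/dF.
by apply/Cn_onS; split=> // v; exact/IH/CF.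
Qed.

Lemma Cn_on_cst n U (k : R) : Cn_on n U (fun=> k).
Proof.
elim: n k => [|n IH] k; first by move=> w _; exact: cvg_cst.
apply/Cn_onS; split=> [w _|v]; first exact: dif_cst.
rewrite (_ : (fun w => _) = fun=> 0) //.
by apply/funext => w; rewrite pd_cst.
Qed.

Lemma Cn_onD n U F G : open U ->
  Cn_on n U F -> Cn_on n U G -> Cn_on n U (fun y => F y + G y).
Proof.
elim: n F G => [|n IH] F G oU.
  by move=> cF cG w Uw; apply: continuousD; [exact: cF|exact: cG].
move=> /Cn_onS[dF CF] /Cn_onS[dG CG]; apply/Cn_onS.
split=> [w Uw|v]; first by apply: difD; [exact: dF|exact: dG].
apply: Cn_on_eq (IH _ _ oU (CF v) (CG v)) => // w Uw.
by rewrite pdD; [|exact: dF|exact: dG].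
Qed.

Lemma Cn_onM n U F G : open U ->
  Cn_on n U F -> Cn_on n U G -> Cn_on n U (fun y => F y * G y).
Proof.
elim: n F G => [|n IH] F G oU CF CG.
  by move=> w Uw; apply: continuousM; [exact: CF|exact: CG].
have [/Cn_onS[dF CdF] /Cn_onS[dG CdG]] := (CF, CG); apply/Cn_onS.
split=> [w Uw|v]; first by apply: difM; [exact: dF|exact: dG].
(* In the Leibniz rule the undifferentiated factor occurs at order [n], hence [Cn_onW]. *)
have := Cn_onD oU (IH _ _ oU (Cn_onW CF) (CdG v)) (IH _ _ oU (Cn_onW CG) (CdF v)).
apply: Cn_on_eq => // w Uw.
by rewrite pdM; [|exact: dF|exact: dG].
Qed.

Lemma Cn_onN n U F : open U -> Cn_on n U F -> Cn_on n U (fun y => - F y).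
Proof.
move=> oU CF; apply: Cn_on_eq (Cn_onM oU (Cn_on_cst n U (-1)) CF) => // w _.
by rewrite mulN1r.
Qed.

End PlaneDerivative.

(** * Quaternion-valued functions on the plane, component by component *)

Section QuatDerivative.
Variable R : realType.
Implicit Types (U : set (R * R)) (F G : R * R -> quat R) (w v : R * R).

Definition qdif F w := [/\ dif (fun y => qre (F y)) w, dif (fun y => qi (F y)) w,
  dif (fun y => qj (F y)) w & dif (fun y => qk (F y)) w].

Definition qd F w v := Quat (pd (fun y => qre (F y)) w v)
  (pd (fun y => qi (F y)) w v) (pd (fun y => qj (F y)) w v)
  (pd (fun y => qk (F y)) w v).

Definition qCn n U F := [/\ Cn_on n U (fun y => qre (F y)),
  Cn_on n U (fun y => qi (F y)), Cn_on n U (fun y => qj (F y))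
  & Cn_on n U (fun y => qk (F y))].

Lemma qd_near F G w : (\forall y \near w, F y = G y) -> qdif F w ->
  qdif G w /\ forall v, qd G w v = qd F w v.
Proof.
move=> FG [/(pd_near (G := fun y => qre (G y))) [|d0 p0]];
  first by apply: filterS FG => y ->.
move=> /(pd_near (G := fun y => qi (G y))) [|d1 p1];
  first by apply: filterS FG => y ->.
move=> /(pd_near (G := fun y => qj (G y))) [|d2 p2];
  first by apply: filterS FG => y ->.
move=> /(pd_near (G := fun y => qk (G y))) [|d3 p3];
  first by apply: filterS FG => y ->.
by split=> // v; congr Quat; [exact: p0|exact: p1|exact: p2|exact: p3].
Qed.

Lemma qdifD F G w : qdif F w -> qdif G w -> qdif (fun y => F y + G y) w.
Proof. by move=> [? ? ? ?] [? ? ? ?]; split; apply: difD. Qed.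

Lemma qdD F G w v : qdif F w -> qdif G w ->
  qd (fun y => F y + G y) w v = qd F w v + qd G w v.
Proof. by move=> [? ? ? ?] [? ? ? ?]; congr Quat; apply: pdD. Qed.

Lemma qdifM F G w : qdif F w -> qdif G w -> qdif (fun y => F y * G y) w.
Proof.
by move=> [? ? ? ?] [? ? ? ?]; split => /=;
  do ?[apply: difD|apply: difM|apply: difN].
Qed.

Lemma qdM F G w v : qdif F w -> qdif G w ->
  qd (fun y => F y * G y) w v = qd F w v * G w + F w * qd G w v.
Proof.
move=> [? ? ? ?] [? ? ? ?]; congr Quat => /=;
rewrite !(pdD, pdN, pdM); do ?[apply: difD|apply: difM|apply: difN] => //=; ring.
Qed.

Lemma qdif_cst (k : quat R) w : qdif (fun=> k) w.
Proof. by split; apply: dif_cst. Qed.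

Lemma qd_cst (k : quat R) w v : qd (fun=> k) w v = 0.
Proof. by rewrite /qd !pd_cst. Qed.

Lemma qCn_qdif n U F w : qCn n.+1 U F -> U w -> qdif F w.
Proof.
by move=> [/Cn_onS[a _] /Cn_onS[b _] /Cn_onS[c _] /Cn_onS[e _]] Uw; split;
  [exact: a|exact: b|exact: c|exact: e].
Qed.

Lemma qCn_eq n U F G :
  open U -> (forall w, U w -> F w = G w) -> qCn n U F -> qCn n U G.
Proof.
move=> oU FG [CF0 CF1 CF2 CF3]; split;
 [apply: Cn_on_eq CF0|apply: Cn_on_eq CF1|apply: Cn_on_eq CF2
 |apply: Cn_on_eq CF3] => // w Uw; by rewrite FG.
Qed.

Lemma qCn_sub n U U' F : U' `<=` U -> qCn n U F -> qCn n U' F.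
Proof. by move=> UU [? ? ? ?]; split; apply: Cn_on_sub UU _. Qed.

Lemma qCn_cst n U (k : quat R) : qCn n U (fun=> k).
Proof. by split; apply: Cn_on_cst. Qed.

Lemma qCnD n U F G : open U -> qCn n U F -> qCn n U G ->
  qCn n U (fun y => F y + G y).
Proof. by move=> oU [? ? ? ?] [? ? ? ?]; split; apply: Cn_onD. Qed.

Lemma qCnM n U F G : open U -> qCn n U F -> qCn n U G ->
  qCn n U (fun y => F y * G y).
Proof.
by move=> oU [? ? ? ?] [? ? ? ?]; split => /=;
  do ?[apply: Cn_onD => //|apply: Cn_onM => //|apply: Cn_onN => //].
Qed.

(** The bridge from the differential of the statement to the locked [qd]. *)
Lemma d_qd (M : topologicalType) (z : chart R M) (F : M -> quat R) p v :
  d z F p v = qd (fun w => F (chart_inv z w)) (z p) v.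
Proof. by rewrite /qd pd.unlock. Qed.

End QuatDerivative.

(** * The quaternion norm and the algebraic identity for the defect *)

Section QuatAlgebra.
Variable R : realType.
Implicit Types (p q n c s r : quat R).

Lemma qdot_ge0 p : 0 <= qdot p p.
Proof. by rewrite /qdot -!expr2 !addr_ge0 ?sqr_ge0. Qed.

Lemma qdot0 : qdot 0 0 = 0 :> R.
Proof. by rewrite /qdot /= !mul0r !addr0. Qed.

Lemma qdot_eq0 p : qdot p p = 0 -> p = 0.
Proof.
have sq (x : R) : x ^+ 2 <= 0 -> x = 0.
  by move=> x0; apply/eqP; rewrite -sqrf_eq0 eq_le x0 sqr_ge0.
case: p => a b c e; rewrite /qdot -!expr2 /= => E.
have := (sqr_ge0 a, sqr_ge0 b, sqr_ge0 c, sqr_ge0 e) => -[[[a0 b0] c0] e0].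
congr Quat; apply: sq; lra.
Qed.

(** Euler's four-square identity. *)
Lemma qdotM p q : qdot (p * q) (p * q) = qdot p p * qdot q q.
Proof. by rewrite /qdot /=; ring. Qed.

Lemma qdot2_le p q : 2 * qdot p q <= qdot p p + qdot q q.
Proof.
rewrite -subr_ge0.
have -> : qdot p p + qdot q q - 2 * qdot p q = qdot (p - q) (p - q).
  by rewrite /qdot /=; ring.
exact: qdot_ge0.
Qed.

(** Parallelogram law: the two sides differ by the squared norm of half of [p - q]. *)
Lemma qdot_mid_le p q : qdot (2^-1 *: (p + q)) (2^-1 *: (p + q)) <=
  2^-1 * (qdot p p + qdot q q).
Proof.
rewrite -subr_ge0; set l := _ - _.
have -> : l = qdot (2^-1 *: (p - q)) (2^-1 *: (p - q)).
  by rewrite /l /qdot /=; field.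
exact: qdot_ge0.
Qed.

Lemma qdot_S2 n : S2 n -> qdot n n = 1.
Proof.
case; rewrite /imH /= => n0 /(congr1 (@qre R)) /=.
by rewrite /qdot n0 !mul0r => E; lra.
Qed.

(* [D], [E], [r] stand for [df], [dN], [rho], and [c], [s] for [a - 1], [b]. *)
Lemma defect_identity (D E n c s r al be : quat R) :
  n * D = - (D * n) -> n * n = -1 -> c * s = s * c ->
  c * c + s * s = - (2 *: c) -> r = - (2^-1 *: c) ->
  let B := 2^-1 *: (n * al * c + al * s) in
  - ((D + E) * al * r) -
    2^-1 *: (E * al * c + n * (- (D * be)) * c + (- (D * be)) * s) =
  2^-1 *: (n * D * (be - B) * c + D * (be - B) * s).
Proof.
move=> nD nn cs cc -> B.
(* Since [n * D * n = D] and [c], [s] commute, the mixed terms in [c] and [s] cancel; what is left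
   is half of [D * al * (c * c + s * s)]. *)
have DB : n * D * B * c + D * B * s = - (D * al * c).
  have nDn : n * D * n = D by rewrite nD mulNr -mulrA nn mulrN1 opprK.
  have Dn : D * n = - (n * D) by rewrite nD opprK.
  have -> : n * D * B * c = 2^-1 *: (D * al * c * c + n * D * al * s * c).
    by rewrite /B -scalerAr -scalerAl mulrDr mulrDl !mulrA nDn.
  have -> : D * B * s = 2^-1 *: (- (n * D * al * c * s) + D * al * s * s).
    by rewrite /B -scalerAr -scalerAl mulrDr mulrDl !mulrA Dn !mulNr.
  rewrite -scalerDr -[_ * s * c]mulrA -cs mulrA addrA addrK -!mulrA -!mulrDr.
  by rewrite cc !mulrN -!scalerAr scalerN scalerA mulVf ?scale1r ?pnatr_eq0.
have lin : n * D * (be - B) * c + D * (be - B) * s =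
    n * D * be * c + D * be * s + D * al * c.
  rewrite !mulrBr !mulrBl addrACA -opprD DB opprK.
  by [].
(* As [r] is [- c / 2], the terms in [E] on the left cancel and half of [D * al * c] remains, which
   matches the last term of [lin]. *)
rewrite lin !mulrN mulrDl -!scalerAr opprK !mulNr mulrDl -scalerBr.
congr (_ *: _); rewrite !mulrA -[X in _ - X]addrA -opprD opprB.
by rewrite [D * al * c + _]addrC [LHS]addrC addrA subrK.
Qed.
End QuatAlgebra.

(** * Gronwall's inequality along a segment *)

Section Gronwall.
Variable R : realType.

(** With [C] the maximum of [K] on [0, 1], the function h(t) exp(-Ct) is nonincreasing and starts at
    0; being nonnegative, it is 0 at 1. *)
Lemma gronwall_eq0 (h h' K : R -> R) :
  (forall t : R, 0 <= t <= 1 -> is_derive t 1 h (h' t)) ->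
  (forall t : R, 0 <= t <= 1 -> h' t <= K t * h t) ->
  {within `[0, 1], continuous K} ->
  (forall t : R, 0 <= h t) -> h 0 = 0 -> h 1 = 0.
Proof.
move=> dh hK cK h0 h00.
have [k _ Kk] := EVT_max ler01 cK; set C := K k in Kk.
pose g (t : R) := h t * expR (- C * t).
have dg (t : R) : 0 <= t <= 1 ->
    is_derive t 1 g ((h' t - C * h t) * expR (- C * t)).
  move=> /dh ht.
  have de : is_derive t 1 (fun t => expR (- C * t)) (expR (- C * t) * - C).
    have dl : is_derive t 1 ( *%R (- C)) (- C).
      have := is_deriveZ (- C) (is_derive_id t 1).
      by rewrite [_ *: _]mulr1.
    exact: is_derive1_comp.
  have := is_deriveM ht de; rewrite /g => /is_derive_eq; apply.
  by rewrite -![_ *: _]/(_ * _); ring.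
have itv01 (t : R) : (t \in `]0, 1[%R) -> 0 <= t <= 1.
  by rewrite in_itv /= => /andP[/ltW -> /ltW ->].
have g10 : g 1 <= g 0.
  apply: (@ler0_derive1_le_cc _ g 0 1); rewrite ?in_itv /= ?lexx ?ler01 //.
  - by move=> t /itv01 /dg[].
  - move=> t /itv01 t01; rewrite derive1E; have [_ ->] := dg _ t01.
    rewrite mulr_le0_ge0 ?expR_ge0 // subr_le0 (le_trans (hK _ t01)) //.
    by rewrite ler_wpM2r // Kk // in_itv.
  - apply: derivable_within_continuous => t; rewrite in_itv => t01.
    by have [] := dg _ t01.
have g1 : g 1 = 0.
  apply/eqP; rewrite eq_le (le_trans g10) ?mulr_ge0 ?expR_ge0 //.
  by rewrite /g h00 mul0r.
by move/eqP: g1; rewrite mulf_eq0 (gt_eqF (expR_gt0 _)) orbF => /eqP.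
Qed.

Lemma qdot_line (X : R * R -> quat R) (w v : R * R) (t : R) : qdif X (w + t *: v) ->
  is_derive t 1 (fun s : R => qdot (X (w + s *: v)) (X (w + s *: v)))
    (2 * qdot (X (w + t *: v)) (qd X (w + t *: v) v)).
Proof.
move=> [/is_derive_line d0 /is_derive_line d1 /is_derive_line d2
  /is_derive_line d3].
have := is_deriveD (is_deriveD (is_deriveD (is_deriveM d0 d0) (is_deriveM d1 d1))
  (is_deriveM d2 d2)) (is_deriveM d3 d3).
move=> /is_derive_eq; apply; rewrite /qdot /=.
rewrite -[qre _ *: _]/(_ * _) -[qi _ *: _]/(_ * _).
by rewrite -[qj _ *: _]/(_ * _) -[qk _ *: _]/(_ * _); ring.
Qed.

(** Gronwall for the squared norm of [X]: its derivative 2<X, dX> is at most |X|^2 + |dX|^2, hence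
    at most (1 + K)|X|^2. *)
Lemma segment_vanish (X : R * R -> quat R) (w v : R * R) (K : R -> R) :
  (forall t : R, 0 <= t <= 1 -> qdif X (w + t *: v)) ->
  (forall t : R, 0 <= t <= 1 ->
    qdot (qd X (w + t *: v) v) (qd X (w + t *: v) v) <=
    K t * qdot (X (w + t *: v)) (X (w + t *: v))) ->
  {within `[0, 1], continuous K} ->
  X w = 0 -> X (w + v) = 0.
Proof.
move=> dX XK cK X0; apply: qdot_eq0; rewrite -(scale1r v).
pose h (s : R) := qdot (X (w + s *: v)) (X (w + s *: v)).
pose h' (s : R) := 2 * qdot (X (w + s *: v)) (qd X (w + s *: v) v).
apply: (@gronwall_eq0 h h' (fun t => 1 + K t)) => [t t01|t t01|||].
- exact/qdot_line/dX.
- by rewrite (le_trans (qdot2_le _ _)) // mulrDl mul1r lerD2l XK.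
- by move=> t; apply: continuousD; [exact: cvg_cst|exact: cK].
- by move=> t; exact: qdot_ge0.
- by rewrite /h scale0r addr0 X0 qdot0.
Qed.

End Gronwall.

(** * Smooth maps on a surface and the rules for their differentials *)

Section MapCalculus.
Variables (R : realType) (M : topologicalType) (A : set (chart R M)).
Implicit Types (z : chart R M) (p : M) (v : R * R) (F G : M -> quat R).

Lemma smooth_mapP F : smooth_map A F <->
  forall z n, A z -> qCn n (chart_img z) (fun w => F (chart_inv z w)).
Proof.
split=> [sF z n Az|sF z Az].
  by have [s0 s1 s2 s3] := sF z Az; split; [exact: s0|exact: s1|exact: s2|exact: s3].
by split=> n; have [] := sF z n Az.
Qed.

Lemma smooth_map_cst (k : quat R) : smooth_map A (fun=> k).
Proof. by apply/smooth_mapP => z n _; exact: qCn_cst. Qed.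

Lemma smooth_mapD F G : smooth_map A F -> smooth_map A G ->
  smooth_map A (fun p => F p + G p).
Proof.
move=> /smooth_mapP sF /smooth_mapP sG; apply/smooth_mapP => z n Az.
by apply: qCnD; [exact: chart_img_open|exact: sF|exact: sG].
Qed.

Lemma smooth_mapM F G : smooth_map A F -> smooth_map A G ->
  smooth_map A (fun p => F p * G p).
Proof.
move=> /smooth_mapP sF /smooth_mapP sG; apply/smooth_mapP => z n Az.
by apply: qCnM; [exact: chart_img_open|exact: sF|exact: sG].
Qed.

Lemma smooth_qdif F z p : smooth_map A F -> A z -> chart_dom z p ->
  qdif (fun w => F (chart_inv z w)) (z p).
Proof.
by move=> /smooth_mapP sF Az zp; apply: qCn_qdif (sF z 1%N Az) _; exists p.
Qed.

Section Rules.
Variables (F G : M -> quat R) (z : chart R M) (p : M) (v : R * R).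
Hypotheses (sF : smooth_map A F) (sG : smooth_map A G).
Hypotheses (Az : A z) (zp : chart_dom z p).

Lemma dD : d z (fun q => F q + G q) p v = d z F p v + d z G p v.
Proof. by rewrite !d_qd qdD //; exact: smooth_qdif. Qed.

Lemma dM : d z (fun q => F q * G q) p v = d z F p v * G p + F p * d z G p v.
Proof.
by rewrite !d_qd qdM /= ?chart_mapK ?inE //; exact: smooth_qdif.
Qed.

Lemma dMcst (k : quat R) : d z (fun q => F q * k) p v = d z F p v * k.
Proof.
rewrite !d_qd qdM; [|exact: smooth_qdif|exact: qdif_cst].
by rewrite qd_cst mulr0 addr0.
Qed.

End Rules.

End MapCalculus.

(** * The isothermic connection in terms of alpha and beta *)

Section ParallelSections.
Variables (R : realType) (M : topologicalType) (A : set (chart R M)).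
Implicit Types (z : chart R M) (p : M) (v : R * R) (al be f g N : M -> quat R).

Lemma section_of0 f al be p :
  section_of f al be p 0 0 = al p + f p * be p.
Proof. by rewrite /section_of /rscale !mxE /= mul1r. Qed.

Lemma section_of1 f al be p : section_of f al be p 1 0 = be p.
Proof. by rewrite /section_of /rscale !mxE /= mul0r add0r mul1r. Qed.

(** The second row of [eta] sends e alpha + psi beta to dg alpha, because the two terms dg f beta
    cancel; the first row is f times the second. *)
Lemma drho_section rho f g al be z p v (Phi := section_of f al be) :
  drho rho f g Phi z p v = col2
    (d z (fun q => al q + f q * be q) p v + f p * d z g p v * al p * rho%:H)
    (d z be p v + d z g p v * al p * rho%:H).
Proof.
have E0 : (fun q => Phi q 0 0) = (fun q => al q + f q * be q).
  by apply/funext => q; exact: section_of0.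
have E1 : (fun q => Phi q 1 0) = be by apply/funext => q; exact: section_of1.
have ord01 (P : 'I_2 -> Prop) : P 0 -> P 1 -> forall i, P i.
  move=> P0 P1 [[|[|//]] i2].
    by have -> : Ordinal i2 = 0 by exact: val_inj.
  by have -> : Ordinal i2 = 1 by exact: val_inj.
have sum2 (F : 'I_2 -> quat R) : \sum_i F i = F 0 + F 1.
  by rewrite big_ord_recl big_ord1; congr (_ + F _); exact: val_inj.
apply/matrixP => i j; rewrite ord1 {j}; move: i; apply: ord01.
  rewrite !mxE /= E0 sum2 /eta !mxE /= !mul1r mul0r add0r mulNr.
  by rewrite mulrDr !mulrA addrK.
rewrite !mxE /= E1 sum2 /eta !mxE /= !mul1r mul0r add0r mulNr.
by rewrite mulrDr !mulrA addrK.
Qed.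

(** The derivative of the first component alpha + f beta contains f dbeta; subtracting f times the
    second equation leaves dalpha + df beta = 0. *)
Lemma drho_parallelP rho f g al be : smooth_map A f ->
  drho_parallel A rho f g (section_of f al be) <->
  [/\ smooth_map A al, smooth_map A be &
    on_tangent A (fun z p v => d z al p v = - (d z f p v * be p) /\
      d z be p v = - (d z g p v * al p * rho%:H))].
Proof.
move=> sf; rewrite /drho_parallel.
have E0 : (fun q => section_of f al be q 0 0) = (fun q => al q + f q * be q).
  by apply/funext => q; exact: section_of0.
have E1 : (fun q => section_of f al be q 1 0) = be.
  by apply/funext => q; exact: section_of1.
split=> [[sPhi dPhi]|[sal sbe dab]].
  have sbe : smooth_map A be by rewrite -E1; exact: sPhi.
  have sal : smooth_map A al.
    (* Only alpha + f beta and beta are known to be smooth, so alpha is recovered from them; the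
       factor -1 replaces a subtraction by a product. *)
    have -> : al = fun q => (al q + f q * be q) + (f q * be q) * -1.
      by apply/funext => q; rewrite mulrN1 addrK.
    apply: smooth_mapD; first by rewrite -E0; exact: sPhi.
    by apply: smooth_mapM; [exact: smooth_mapM|exact: smooth_map_cst].
  split=> // z p v Az zp.
  have := dPhi z p v Az zp; rewrite drho_section => /matrixP dP.
  have := dP 1 0; rewrite !mxE /= => dbe.
  have db : d z be p v = - (d z g p v * al p * rho%:H).
    by apply/eqP; rewrite -addr_eq0 dbe.
  split=> //; apply/eqP; rewrite -addr_eq0; apply/eqP.
  have := dP 0 0; rewrite !mxE /=.
  rewrite (dD v sal (smooth_mapM sf sbe) Az zp) (dM v sf sbe Az zp) db.
  by rewrite mulrN !mulrA addrA subrK.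
split=> [i|z p v Az zp].
  have sab := smooth_mapD sal (smooth_mapM sf sbe).
  case: i => [[|[|//]] i2].
    by have -> : Ordinal i2 = 0 by [exact: val_inj]; rewrite E0.
  by have -> : Ordinal i2 = 1 by [exact: val_inj]; rewrite E1.
have [dal dbe] := dab z p v Az zp.
rewrite drho_section (dD v sal (smooth_mapM sf sbe) Az zp) (dM v sf sbe Az zp).
rewrite dal dbe addrA addNr add0r mulrN !mulrA !addNr.
by apply/matrixP => i j; rewrite !mxE; case: i => [[|[|//]] i2].
Qed.

End ParallelSections.

(** * Relations between the spectral parameters *)

Section Coefficients.
Variable R : realType.
Implicit Types x y : R[i].

Lemma cplxHD x y : (x + y)%:H = x%:H + y%:H.
Proof. by case: x => a b; case: y => c e; congr Quat => /=; rewrite addr0. Qed.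

Lemma cplxHN x : (- x)%:H = - x%:H.
Proof. by case: x => a b; congr Quat => /=; rewrite oppr0. Qed.

Lemma cplxHM x y : (x * y)%:H = x%:H * y%:H.
Proof. by case: x => a b; case: y => c e; congr Quat => /=; ring. Qed.

Lemma quat_double (q : quat R) : 2 *: q = q + q.
Proof. by rewrite -[2]/(1 + 1) scalerDl scale1r. Qed.

Variable mu : R[i].
Hypothesis mu0 : mu != 0.
Let a := (mu + mu^-1) / 2.
Let b := 'i * ((mu^-1 - mu) / 2).

(** From a^2 + b^2 = 1 one gets (a - 1)^2 + b^2 = 2 - 2a. *)
Lemma coef_sqr : (a - 1)%:H * (a - 1)%:H + b%:H * b%:H = - (2 *: (a - 1)%:H).
Proof.
rewrite quat_double -!cplxHM -!cplxHD -cplxHN; congr cplxH.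
have i2 : 'i * 'i = -1 :> R[i] by rewrite -expr2 sqr_i.
have -> : b * b = - ((mu^-1 - mu) / 2) ^+ 2 by rewrite /b mulrACA i2 mulN1r.
by rewrite /a; field; rewrite ?mu0 ?pnatr_eq0.
Qed.

(** Here a - 1 = (mu - 1)^2 / (2 mu), which is -2 rho. *)
Lemma coef_rho : (- ((mu - 1) ^+ 2 / (4 * mu)))%:H = - (2^-1 *: (a - 1)%:H).
Proof.
(* The double is written [r + r] so that it passes through the embedding by additivity and becomes a
   real scalar on quaternions. *)
pose r := - ((mu - 1) ^+ 2 / (4 * mu)); have E : a - 1 = - (r + r).
  by rewrite /r /a; field; rewrite ?mu0 ?pnatr_eq0.
rewrite -/r E (cplxHN (r + r)) cplxHD scalerN opprK -quat_double scalerA.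
by rewrite mulVf ?scale1r ?pnatr_eq0.
Qed.

Lemma coef_comm : (a - 1)%:H * b%:H = b%:H * (a - 1)%:H.
Proof. by rewrite -!cplxHM mulrC. Qed.

End Coefficients.

(** * Path-connectedness, and lifting charts and maps to a covering space *)

Section Covering.
Variable R : realType.

(** The image of a path from [x] to [y] is connected, and [Z] meets it in a nonempty subset that is
    both open and closed. *)
Lemma path_connected_ind (T : topologicalType) (Z : set T) (x y : T) :
  path_connected R T -> open Z -> open (~` Z) -> Z x -> Z y.
Proof.
move=> pT oZ oZC Zx; apply: contrapT => nZy.
have [c [cc c0 c1]] := pT x y.
have cT : connected (c @` `[0, 1]).
  by apply: connected_continuous_connected => //; exact: segment_connected.
have sep : c @` `[0, 1] = (c @` `[0, 1]) `&` Z.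
  apply/esym/cT.
  - exists x; split=> //; exists 0 => //=; by rewrite in_itv /= lexx ler01.
  - by exists Z.
  - by exists Z => //; rewrite -[X in closed X]setCK; exact: open_closedC.
have : (c @` `[0, 1]) y by exists 1 => //=; rewrite in_itv /= lexx ler01.
by rewrite sep => -[_ /nZy].
Qed.

(** [lift_atlas] only selects charts, so their existence has to be shown. On the part of the sheet
    through [q] that lies over the domain of [z], the map [z \o cov] is a chart with inverse
    [s i \o chart_inv z]. *)
Lemma lift_atlas_cover (M Mt : topologicalType) (A : set (chart R M))
    (cov : Mt -> M) (q : Mt) :
  (forall p, exists2 z, A z & chart_dom z p) -> covering_map cov ->
  exists2 zt, lift_atlas cov A zt & chart_dom zt q.
Proof.
move=> Acov [ccov _ ev]; have [z Az zq] := Acov (cov q).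
have [U [oU Uq [I [V [s [covU _ oV sV cs]]]]]] := ev (cov q).
have [i _ Viq] : (\bigcup_i V i) q by rewrite -covU.
have [[sU sinj ssurj] sK] := sV i.
have Us q' : V i q' -> U (cov q') /\ s i (cov q') = q'.
  by move=> /ssurj[u Uu <-]; rewrite sK ?inE.
pose D := V i `&` cov @^-1` chart_dom z.
have oD : open D.
  by apply: openI => //; apply: open_comp (@chart_dom_open _ _ z) => ? _; exact: ccov.
have cin : {in chart_img z, continuous (chart_inv z)}.
  by rewrite -continuous_open_subspace; [exact: chart_inv_cont|exact: chart_img_open].
(* In this form the image is visibly open: it is the preimage of [U] under the inverse chart, which
   is continuous on an open set. *)
have imD : (z \o cov) @` D = chart_img z `&` (chart_inv z) @^-1` U.
  apply/seteqP; split=> [_ [q' [Vq' zq'] <-]|w [[p zp <-]]] /=.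
    by split; [exists (cov q')|rewrite /= chart_mapK ?inE //; have [] := Us q' Vq'].
  rewrite chart_mapK ?inE // => Up; exists (s i p); last by rewrite /= sK ?inE.
  by split; [exact: sU|rewrite /= sK ?inE].
have oimD : open ((z \o cov) @` D).
  rewrite imD.
  by have [H _] := continuous_inP (chart_inv z) (@chart_img_open _ _ z); exact: H.
have zK : {in D, cancel (z \o cov) (s i \o chart_inv z)}.
  move=> q'; rewrite inE => -[Vq' zq'] /=.
  by rewrite chart_mapK ?inE //; have [] := Us q' Vq'.
have zc : {within D, continuous (z \o cov)}.
  rewrite continuous_open_subspace // => q'; rewrite inE => -[Vq' zq'].
  apply: continuous_comp; first exact: ccov.
  have := @chart_map_cont _ _ z; rewrite continuous_open_subspace.
    by apply; rewrite inE.
  exact: chart_dom_open.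
have ic : {within (z \o cov) @` D, continuous (s i \o chart_inv z)}.
  rewrite continuous_open_subspace // => w; rewrite inE imD => -[zw Uw].
  apply: continuous_comp; first by apply: cin; rewrite inE.
  have := cs i; rewrite continuous_open_subspace //.
  by apply; rewrite inE.
by exists (Chart oD oimD zK zc ic) => //; exists z => // q' [].
Qed.

Variables (M Mt : topologicalType) (A : set (chart R M)) (cov : Mt -> M).
Variable F : M -> quat R.
Hypothesis sF : smooth_map A F.

(** The two charts give [q] and [cov q] the same coordinates, so [F] and its lift are the same
    function of them. Smoothness and differentials of lifts follow. *)
Lemma lift_chart (z : chart R M) (zt : chart R Mt) :
  (forall q, chart_dom zt q -> chart_dom z (cov q) /\ zt q = z (cov q)) ->
  chart_img zt `<=` chart_img z /\
  forall w, chart_img zt w -> F (chart_inv z w) = (F \o cov) (chart_inv zt w).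
Proof.
move=> zzt; split=> _ [q zq <-]; have [zcq E] := zzt q zq.
  by rewrite E; exists (cov q).
by rewrite /= chart_mapK ?inE // E chart_mapK ?inE.
Qed.

Lemma smooth_map_lift : smooth_map (lift_atlas cov A) (F \o cov).
Proof.
apply/smooth_mapP => zt n [z Az /lift_chart[sub FE]].
have /smooth_mapP sF' := sF.
by apply: qCn_eq (qCn_sub sub (sF' z n Az)); first exact: chart_img_open.
Qed.

Lemma d_lift (z : chart R M) (zt : chart R Mt) q v : A z ->
  (forall q, chart_dom zt q -> chart_dom z (cov q) /\ zt q = z (cov q)) ->
  chart_dom zt q -> d zt (F \o cov) q v = d z F (cov q) v.
Proof.
move=> Az zzt ztq; have [sub FE] := lift_chart zzt.
have [zcq E] := zzt q ztq; rewrite !d_qd -E.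
have near_eq : \forall w \near zt q,
    F (chart_inv z w) = (F \o cov) (chart_inv zt w).
  apply: filterS FE (open_nbhs_nbhs _); split; first exact: chart_img_open.
  by exists q.
have dF : qdif (fun w => F (chart_inv z w)) (zt q).
  by rewrite E; exact: smooth_qdif sF Az zcq.
by have [_ ->] := qd_near near_eq dF.
Qed.

End Covering.

(** * Unique continuation for the linear equation of the defect *)

Section Vanishing.
Variables (R : realType) (M : topologicalType) (A : set (chart R M)).
Variables (f N : M -> quat R).
Hypotheses (sf : smooth_map A f) (NS2 : forall p, S2 (N p)).

(** Makes the Gronwall bound continuous in [t]. [Cn_on] gives continuity of the derivative in each
    fixed direction, which is enough because [v] is constant along the segment. *)
Lemma pd_line_continuous (U : set (R * R)) (F : R * R -> R) (w v : R * R) :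
  Cn_on 1 U F -> (forall t : R, 0 <= t <= 1 -> U (w + t *: v)) ->
  {within `[0, 1], continuous (fun t : R => pd F (w + t *: v) v)}.
Proof.
move=> /Cn_onS[_ CF] Uwv; apply: continuous_in_subspaceT => t.
rewrite inE /= in_itv /= => t01.
have line_cont : {for t, continuous (fun t : R => w + t *: v)}.
  by apply: cvgD; [exact: cvg_cst|exact: scalel_continuous].
exact: continuous_comp line_cont (CF v _ (Uwv t t01)).
Qed.

Variables (X : M -> quat R) (c s : quat R).
Hypotheses (sX : smooth_map A X).
Hypothesis dX : on_tangent A (fun z p v => d z X p v =
  2^-1 *: (N p * d z f p v * X p * c + d z f p v * X p * s)).

(** The norm is multiplicative and |N| = 1, so the two summands of dX have squared norms |df|^2
    |X|^2 |c|^2 and |df|^2 |X|^2 |s|^2. *)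
Lemma qdot_dX z p v : A z -> chart_dom z p ->
  qdot (d z X p v) (d z X p v) <=
  2^-1 * (qdot (d z f p v) (d z f p v) * (qdot c c + qdot s s)) *
  qdot (X p) (X p).
Proof.
move=> Az zp; rewrite dX //; apply: le_trans (qdot_mid_le _ _) _.
by rewrite !qdotM (qdot_S2 (NS2 p)) mul1r -!mulrA ler_wpM2l ?invr_ge0 //; lra.
Qed.

Lemma chart_segment_vanish z (w v : R * R) : A z ->
  (forall t : R, 0 <= t <= 1 -> chart_img z (w + t *: v)) ->
  X (chart_inv z w) = 0 -> X (chart_inv z (w + v)) = 0.
Proof.
move=> Az seg X0; pose D t := qd (fun y => f (chart_inv z y)) (w + t *: v) v.
(* The factor of [qdot_dX] at the point with coordinates [w + t *: v]. *)
pose K (t : R) := 2^-1 * (qdot (D t) (D t) * (qdot c c + qdot s s)).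
have inv_dom t : 0 <= t <= 1 ->
    exists2 p, chart_dom z p & chart_inv z (w + t *: v) = p /\ z p = w + t *: v.
  by move=> /seg[p zp E]; exists p => //; rewrite -E chart_mapK ?inE.
apply: (@segment_vanish _ (fun y => X (chart_inv z y)) w v K) => //.
- by move=> t /inv_dom[p zp [_ <-]]; exact: smooth_qdif sX Az zp.
- move=> t /inv_dom[p zp [Ep Ez]].
  have := qdot_dX v Az zp; rewrite !d_qd Ez /K /D.
  by rewrite Ep.
- have /smooth_mapP/(_ z 1%N Az)[f0 f1 f2 f3] := sf.
  have [[[c0 c1] c2] c3] := (pd_line_continuous f0 seg, pd_line_continuous f1 seg,
    pd_line_continuous f2 seg, pd_line_continuous f3 seg).
  have ccst (k : R) : {within `[0 : R, 1], continuous (fun=> k)}.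
    by move=> t; exact: cvg_cst.
  have cD (h k : R -> R) : {within `[0 : R, 1], continuous h} ->
      {within `[0 : R, 1], continuous k} ->
      {within `[0 : R, 1], continuous (fun t : R => h t + k t)}.
    by move=> ch ck t; exact: continuousD (ch t) (ck t).
  have cM (h k : R -> R) : {within `[0 : R, 1], continuous h} ->
      {within `[0 : R, 1], continuous k} ->
      {within `[0 : R, 1], continuous (fun t : R => h t * k t)}.
    by move=> ch ck t; exact: continuousM (ch t) (ck t).
  apply: (cM _ _ (ccst _) (cM _ _ _ (ccst _))).
  exact: (cD _ _ (cD _ _ (cD _ _ (cM _ _ c0 c0) (cM _ _ c1 c1)) (cM _ _ c2 c2))
    (cM _ _ c3 c3)).
Qed.

(** [W] is a coordinate ball. It is convex, so any two of its points are joined by a coordinate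
    segment along which a zero propagates. *)
Lemma locally_vanish z q : A z -> chart_dom z q ->
  exists W : set M, [/\ open W, W q &
    forall p p', W p -> W p' -> X p = 0 -> X p' = 0].
Proof.
move=> Az zq.
have : nbhs (z q) (chart_img z).
  by apply: open_nbhs_nbhs; split; [exact: chart_img_open|exists q].
move=> /nbhs_ballP[e /= e0 be].
exists (chart_dom z `&` z @^-1` ball (z q) e); split.
- have [H _] := continuous_inP z (@chart_dom_open _ _ z).
  apply: H; last exact: ball_open.
  rewrite -continuous_open_subspace; first exact: chart_map_cont.
  exact: chart_dom_open.
- by split=> //=; exact: ballxx.
move=> p p' [zp bp] [zp' bp'] Xp.
have := @chart_segment_vanish z (z p) (z p' - z p) Az.
rewrite [z p + (z p' - z p)]addrC subrK !chart_mapK ?inE //; apply=> // t /andP[t0 t1].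
apply: be; move: bp bp'; rewrite /= -!ball_normE /ball_ /= => bp bp'.
(* Convexity of the ball: the offset from the centre is a convex combination of the offsets of the
   end points. *)
have -> : z q - (z p + t *: (z p' - z p)) =
    (1 - t) *: (z q - z p) + t *: (z q - z p').
  have -> : z q - z p' = (z q - z p) - (z p' - z p) by rewrite opprB addrA subrK.
  by rewrite opprD addrA scalerBl scale1r [t *: (_ - (_ - _))]scalerBr addrA subrK.
apply: le_lt_trans (ler_normD _ _) _; rewrite !normrZ.
rewrite (ger0_norm t0) ger0_norm ?subr_ge0 //.
have -> : e = (1 - t) * e + t * e by rewrite mulrBl mul1r subrK.
(* Strictness comes from the second summand, unless [t = 0], where it comes from the first. *)
case: (eqVneq t 0) => [->|tn0]; first by rewrite subr0 !mul0r !addr0 !mul1r.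
apply: ler_ltD; first by rewrite ler_wpM2l ?subr_ge0 // ltW.
by rewrite ltr_pM2l // lt_neqAle eq_sym tn0.
Qed.

Lemma vanish_of_vanish_at p0 : path_connected R M ->
  (forall p, exists2 z, A z & chart_dom z p) -> X p0 = 0 -> forall p, X p = 0.
Proof.
move=> pM Acov X0 p.
have loc q : exists W : set M, [/\ open W, W q &
    forall p p', W p -> W p' -> X p = 0 -> X p' = 0].
  by have [z Az zq] := Acov q; exact: locally_vanish Az zq.
apply: (@path_connected_ind _ _ [set q | X q = 0] p0 p pM) => //=.
- rewrite openE => q /= Xq; have [W [oW Wq XW]] := loc q.
  by apply: filterS (open_nbhs_nbhs (conj oW Wq)) => q' Wq'; exact: XW Xq.
(* The same [W] read backwards: a zero at a nearby [q'] would force one at [q]. *)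
- rewrite openE => q /= Xq; have [W [oW Wq XW]] := loc q.
  apply: filterS (open_nbhs_nbhs (conj oW Wq)) => q' Wq' Xq'.
  by apply: Xq; exact: XW Xq'.
Qed.

End Vanishing.

(** * Correspondence between the two families of parallel sections *)

Section Main.
Variables (R : realType) (M : topologicalType) (A : set (chart R M)).
Variables (f N : M -> quat R) (mu : R[i]).
Hypotheses (sf : smooth_map A f) (sN : smooth_map A N).
Hypothesis NS2 : forall p, S2 (N p).
Hypothesis Ndf : on_tangent A (fun z p v =>
  N p * d z f p v = - (d z f p v * N p)).
Hypothesis mu0 : mu != 0.

Let rho := - ((mu - 1) ^+ 2 / (4 * mu)).
Let c := ((mu + mu^-1) / 2 - 1)%:H.
Let s := ('i * ((mu^-1 - mu) / 2))%:H.
Let g := fun p => f p + N p.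

(* The scalar [2^-1] is put on the right to make [transform] a product of maps. *)
Definition transform (al : M -> quat R) : M -> quat R :=
  fun p => (N p * al p * c + al p * s) * 2^-1%:A.

Lemma transformE al p : transform al p = 2^-1 *: (N p * al p * c + al p * s).
Proof. by rewrite /transform -scalerAr mulr1. Qed.

Lemma smooth_transform al : smooth_map A al -> smooth_map A (transform al).
Proof.
move=> sal; apply: smooth_mapM; last exact: smooth_map_cst.
by apply: smooth_mapD; apply: smooth_mapM; try exact: smooth_map_cst;
  try exact: smooth_mapM.
Qed.

(** Once dbeta = - dg alpha rho, the left side is the derivative of the defect. That equation is not
    assumed, so the identity serves both directions: for a given beta, and for beta =
    [transform al], where the right side is 0 and the equation results. *)
Lemma d_transform al be z p v : smooth_map A al -> A z -> chart_dom z p ->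
  d z al p v = - (d z f p v * be p) ->
  - (d z g p v * al p * rho%:H) - d z (transform al) p v =
  2^-1 *: (N p * d z f p v * (be p - transform al p) * c +
           d z f p v * (be p - transform al p) * s).
Proof.
move=> sal Az zp dal.
have sNa : smooth_map A (fun q => N q * al q) by exact: smooth_mapM.
have sk (F : M -> quat R) k : smooth_map A F -> smooth_map A (fun q => F q * k).
  by move=> sF; apply: smooth_mapM => //; exact: smooth_map_cst.
rewrite (dMcst v (smooth_mapD (sk _ c sNa) (sk _ s sal)) Az zp).
rewrite (dD v (sk _ c sNa) (sk _ s sal) Az zp) (dMcst v sNa Az zp).
rewrite (dMcst v sal Az zp) (dM v sN sal Az zp) dal (dD v sf sN Az zp).
rewrite transformE -scalerAr mulr1 [(_ + N p * _) * c]mulrDl.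
by apply: defect_identity; [exact: Ndf|have [] := NS2 p|exact: coef_comm
  |exact: coef_sqr|exact: coef_rho].
Qed.

Lemma dN_parallelP al : dN_parallel A mu f N al <->
  smooth_map A al /\
  on_tangent A (fun z p v => d z al p v = - (d z f p v * transform al p)).
Proof.
have E z p v : (dN mu f N al z p v = 0) <->
    (d z al p v = - (d z f p v * transform al p)).
  rewrite transformE -scalerAr /dN; split=> [/eqP|->]; last by rewrite addNr.
  by rewrite addr_eq0 => /eqP.
by split=> -[sal H]; split=> // z p v Az zp; exact/E/H.
Qed.

Lemma parallel_transform al : dN_parallel A mu f N al ->
  drho_parallel A rho f g (section_of f al (transform al)).
Proof.
move=> /dN_parallelP[sal dal]; apply/drho_parallelP => //.
split=> //; first exact: smooth_transform.
move=> z p v Az zp; split; first exact: dal.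
have := d_transform sal Az zp (dal z p v Az zp).
rewrite (subrr (transform al p)) mulr0 mul0r mulr0 mul0r addr0 scaler0 => /eqP.
by rewrite subr_eq0 => /eqP ->.
Qed.

Lemma parallel_of_initial al be p0 : path_connected R M ->
  (forall p, exists2 z, A z & chart_dom z p) ->
  drho_parallel A rho f g (section_of f al be) ->
  be p0 = transform al p0 -> dN_parallel A mu f N al.
Proof.
move=> pM Acov /drho_parallelP[//|sal sbe dab] be0.
have str := smooth_transform sal.
(* The defect, written with a sum and a product so that the rules for smooth maps apply. *)
pose X p := be p + transform al p * -1.
have XE p : X p = be p - transform al p by rewrite /X mulrN1.
have sX : smooth_map A X.
  by apply: smooth_mapD => //; apply: smooth_mapM => //; exact: smooth_map_cst.
have dX : on_tangent A (fun z p v => d z X p v =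
    2^-1 *: (N p * d z f p v * X p * c + d z f p v * X p * s)).
  move=> z p v Az zp; have [dal dbe] := dab z p v Az zp.
  rewrite XE -(d_transform sal Az zp dal) -dbe.
  rewrite (dD v sbe _ Az zp) ?(dMcst v str Az zp) ?mulrN1 //.
  by apply: smooth_mapM => //; exact: smooth_map_cst.
have X0 : X p0 = 0 by rewrite XE be0 subrr.
have XT := vanish_of_vanish_at sf NS2 sX dX pM Acov X0.
apply/dN_parallelP; split=> // z p v Az zp.
have [-> _] := dab z p v Az zp; congr (- (_ * _)).
by apply/eqP; rewrite -subr_eq0 -XE XT.
Qed.

End Main.

(** * The correspondence on the universal cover *)

Theorem theorem4p5 (R : realType) (M Mt : topologicalType)
    (A : set (chart R M)) (cov : Mt -> M) (f N : M -> quat R) (mu : R[i])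
    (p0 : Mt) :
  riemann_surface A ->
  universal_cover R cov ->
  cmc1_surface A f N ->
  ~ round_sphere f ->
  mu != 0 -> mu != 1 -> mu != -1 ->
  let At := lift_atlas cov A in
  let ft := f \o cov in
  let Nt := N \o cov in
  let gt := dual_surface f N \o cov in
  let rho := - ((mu - 1) ^+ 2 / (4 * mu)) in
  let a := (mu + mu^-1) / 2 in
  let b := 'i * ((mu^-1 - mu) / 2) in
  let initial (alpha beta : Mt -> quat R) :=
    beta p0 = 2^-1 *: (Nt p0 * alpha p0 * (a - 1)%:H + alpha p0 * b%:H) in
  (forall alpha beta : Mt -> quat R,
     drho_parallel At rho ft gt (section_of ft alpha beta) ->
     initial alpha beta ->
     dN_parallel At mu ft Nt alpha) /\
  (forall alpha : Mt -> quat R,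
     dN_parallel At mu ft Nt alpha ->
     exists beta : Mt -> quat R,
       drho_parallel At rho ft gt (section_of ft alpha beta) /\
       initial alpha beta).
Proof.
move=> [_ _ Acov _] [covM [pMt _]] [[sf _ _ _] [sN NS2 star_df] _] _ mu0 _ _.
move=> At ft Nt gt rho a b initial.
have sft : smooth_map At ft by exact: smooth_map_lift.
have sNt : smooth_map At Nt by exact: smooth_map_lift.
have Nt_S2 q : S2 (Nt q) by exact: NS2.
have Atcov q : exists2 zt, At zt & chart_dom zt q by exact: lift_atlas_cover.
(* Equating the two expressions for *df in [gauss_map] gives N df = - df N on the surface; [d_lift]
   carries it to the cover. *)
have Ndf : on_tangent At (fun z q v =>
    Nt q * d z ft q v = - (d z ft q v * Nt q)).
  move=> zt q v [z Az zzt] ztq; rewrite (d_lift sf v Az zzt ztq).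
  have [zq _] := zzt q ztq; have [E1 E2] := star_df z (cov q) v Az zq.
  by rewrite -E1 -E2.
split=> [al be par ini|al par].
  apply: (parallel_of_initial sft sNt Nt_S2 Ndf mu0 pMt Atcov par (p0 := p0)).
  by rewrite transformE.
exists (transform Nt mu al); split; last exact: transformE.
exact: parallel_transform.
Qed.
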